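(* $\mathrm{ex}'(n,\{\text{crossing},\text{swords}\})\in O(n)$.
   Context: Let $P$ be a set of $n$ points in convex position in the plane (the vertices of a convex $n$-gon); a triangle on $P$ is a 3-element subset of $P$. For two distinct triangles $t_1,t_2$ on $P$, label each point of $t_1\cup t_2$ by the triangle(s) containing it and read the points in their cyclic order around the polygon. The pair forms exactly one of eight configurations. (i) If $t_1,t_2$ share two vertices $u,v$: ''taco'' if their third vertices lie on the same side of the line $uv$, ''mariposa'' if on opposite sides. (ii) If they share exactly one vertex $v$: read the remaining four vertices in cyclic order starting just after $v$; ''bat'' if the pattern is $t_1t_1t_2t_2$ or $t_2t_2t_1t_1$, ''nested'' if it is $t_1t_2t_2t_1$ or $t_2t_1t_1t_2$, ''crossing'' if it is $t_1t_2t_1t_2$ or $t_2t_1t_2t_1$. (iii) If they share no vertex, the cyclic sequence of the six labels is, up to rotation, reflection and exchanging the roles of $t_1,t_2$, one of: ''ears'' $AAABBB$, ''swords'' $AABABB$, ''david'' $ABABAB$. Top/bottom variant: partition the vertices of the convex $n$-gon by a horizontal line into a top half of $\lceil n/2\rceil$ vertices and a bottom half of $\lfloor n/2\rfloor$ vertices (each half consisting of consecutive vertices along the polygon). For a set $X$ of configurations, $\mathrm{ex}'(n,X)$ is the maximum size of a family of triangles on $P$, each having exactly two vertices in the top half and one vertex in the bottom half, in which no two triangles form a configuration belonging to $X$. *)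

(* Defs.v *)
From HB Require Import structures.
From mathcomp Require Import all_boot.

Set Implicit Arguments.
Unset Strict Implicit.
Unset Printing Implicit Defensive.

(* The vertices of the convex n-gon are the elements of 'I_n, numbered in     *)
(* their cyclic order around the polygon.                                     *)

Inductive config :=
  Taco | Mariposa | Bat | Nested | Crossing | Ears | Swords | David.

Definition config_code (c : config) : nat :=
  match c with
  | Taco => 0 | Mariposa => 1 | Bat => 2 | Nested => 3
  | Crossing => 4 | Ears => 5 | Swords => 6 | David => 7
  end.

Definition config_ord (c : config) : 'I_8 := inord (config_code c).

Definition config_dec (i : 'I_8) : config :=
  nth Taco [:: Taco; Mariposa; Bat; Nested; Crossing; Ears; Swords; David] i.

Lemma config_ordK : cancel config_ord config_dec.
Proof. by case; rewrite /config_dec inordK. Qed.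

HB.instance Definition _ := Finite.copy config (can_type config_ordK).

Section Configurations.
Variable n : nat.
Implicit Types (t : {set 'I_n}) (s : seq 'I_n) (p : seq bool).

Definition is_triangle t := #|t| == 3.

(* Labels, along the vertex sequence s, of the vertices that belong to        *)
(* exactly one of t1, t2: true stands for t1 and false for t2.                *)
Definition labels s t1 t2 : seq bool :=
  [seq x \in t1 | x <- s & x \in (t1 :|: t2) :\: (t1 :&: t2)].

(* All vertices in cyclic order, starting just after v and ending with v.     *)
Definition vertices_after (v : 'I_n) : seq 'I_n := rot v.+1 (enum 'I_n).

(* In a convex polygon, the vertices strictly on one side of the line through *)
(* the vertices u < v are exactly those numbered strictly between u and v.    *)
Definition same_side (u v x y : 'I_n) : bool := (u < x < v) == (u < y < v).

Definition share2 (same : bool) t1 t2 : bool :=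
  [exists u : 'I_n, exists v : 'I_n, exists x : 'I_n, exists y : 'I_n,
    [&& u < v, t1 :&: t2 == [set u; v], t1 :\: t2 == [set x],
        t2 :\: t1 == [set y] & same_side u v x y == same]].

Definition share1 p t1 t2 : bool :=
  [exists v : 'I_n, (t1 :&: t2 == [set v]) &&
    (labels (vertices_after v) t1 t2 \in [:: p; map negb p])].

(* Images of p under rotation, reflection and exchange of the two labels.     *)
Definition variants p : seq (seq bool) :=
  [seq rot k q | k <- iota 0 (size p),
                 q <- [:: p; rev p; map negb p; map negb (rev p)]].

Definition share0 p t1 t2 : bool :=
  (t1 :&: t2 == set0) && (labels (enum 'I_n) t1 t2 \in variants p).

Definition forms (c : config) t1 t2 : bool :=
  match c with
  | Taco => share2 true t1 t2
  | Mariposa => share2 false t1 t2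
  | Bat => share1 [:: true; true; false; false] t1 t2
  | Nested => share1 [:: true; false; false; true] t1 t2
  | Crossing => share1 [:: true; false; true; false] t1 t2
  | Ears => share0 [:: true; true; true; false; false; false] t1 t2
  | Swords => share0 [:: true; true; false; true; false; false] t1 t2
  | David => share0 [:: true; false; true; false; true; false] t1 t2
  end.

(* The numbering starts at the first vertex of the top half; uphalf n is the  *)
(* ceiling of n / 2.                                                          *)
Definition top_half : {set 'I_n} := [set i : 'I_n | i < uphalf n].
Definition bottom_half : {set 'I_n} := ~: top_half.

Definition top_top_bottom t : bool :=
  [&& is_triangle t, #|t :&: top_half| == 2 & #|t :&: bottom_half| == 1].

Definition avoids (X : {set config}) (F : {set {set 'I_n}}) : bool :=
  [forall t1 in F, forall t2 in F,
     (t1 != t2) ==> [forall c in X, ~~ forms c t1 t2]].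

Definition admissible (X : {set config}) (F : {set {set 'I_n}}) : bool :=
  [forall t in F, top_top_bottom t] && avoids X F.

End Configurations.

Definition ex' (n : nat) (X : {set config}) : nat :=
  \max_(F : {set {set 'I_n}} | admissible X F) #|F|.

(* Main.v *)
(* Write a triangle as (a, b, c) with top vertices a < b and bottom vertex c.
   For two triangles of an admissible family, the relative position of the
   intervals (a, b) and (a', b') dictates the order of c and c'; in particular
   the sets of bottom vertices attached to two different intervals share at most
   an endpoint.
   Hence every triangle that is not the one of least bottom vertex over its
   interval is determined by its bottom vertex, which gives at most n triangles.
   For the remaining ones it suffices to count intervals.  If (a, b) were
   neither the longest interval with left endpoint a nor the longest with right
   endpoint b, there would be intervals (a, b+) and (a-, b) with bottoms
   c+ <= c <= c-, whereas (a-, b) and (a, b+) interleave, which forces c- < c+.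
   So there are at most 2n intervals. *)
Require Import Defs.
From mathcomp Require Import all_boot.
From mathcomp Require Import zify.

Set Implicit Arguments.
Unset Strict Implicit.
Unset Printing Implicit Defensive.

Lemma disjoint_uniq_cat (T : eqType) (r1 r2 : seq T) (x : T) :
  uniq (r1 ++ r2) -> (x \in r1) && (x \in r2) = false.
Proof.
rewrite cat_uniq => /and3P[_ /hasPn r12 _].
by apply/negP=> /andP[xr1 /r12]; rewrite /= xr1.
Qed.

(** * Label sequences along the cyclic order *)

Section Labels.
Variable n : nat.
Implicit Types (t : {set 'I_n}) (s : seq 'I_n) (v x y : 'I_n).

Let lto : rel 'I_n := fun x y => x < y.

Lemma sorted_enum_ord : sorted lto (enum 'I_n).
Proof.
rewrite -(sorted_map (f := val) (e' := ltn)) val_enum_ord.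
exact: iota_ltn_sorted.
Qed.

(** A strictly increasing list is determined by its elements, so an explicit sorted list can stand
    for a filtered enumeration. *)
Lemma filter_enum_ord (P : pred 'I_n) s :
  sorted lto s -> s =i P -> filter P (enum 'I_n) = s.
Proof.
have lt_tr : transitive lto by move=> y x z; exact: ltn_trans.
move=> s_sorted sP; apply: (irr_sorted_eq lt_tr) => //.
- by move=> x; rewrite /lto ltnn.
- exact: sorted_filter sorted_enum_ord.
- by move=> x; rewrite mem_filter mem_enum andbT sP.
Qed.

(** The rotation cuts the enumeration just after [v]. Writing both blocks as filters lets
    [filter_enum_ord] handle each block, although the whole list is not sorted. *)
Lemma vertices_afterE v :
  vertices_after v =
    [seq x : 'I_n <- enum 'I_n | v < x] ++
    [seq x : 'I_n <- enum 'I_n | x <= v].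
Proof.
have filter_val (P : pred nat) :
    [seq val x | x : 'I_n <- [seq x : 'I_n <- enum 'I_n | P x]]
      = filter P (iota 0 n).
  by rewrite -val_enum_ord filter_map.
have iotaE : iota 0 n = iota 0 v.+1 ++ iota v.+1 (n - v.+1).
  by rewrite -iotaD subnKC.
rewrite /vertices_after /rot; congr (_ ++ _); apply: (inj_map val_inj).
  rewrite (filter_val (fun i => v < i)) map_drop val_enum_ord.
  rewrite iotaE drop_size_cat ?size_iota // filter_cat.
  rewrite (eq_in_filter (a2 := pred0)) ?filter_pred0; last first.
    by move=> i; rewrite mem_iota /=; lia.
  rewrite (eq_in_filter (a2 := predT)) ?filter_predT //.
  by move=> i; rewrite mem_iota /=; lia.
rewrite (filter_val (fun i => i <= v)) map_take val_enum_ord.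
rewrite iotaE take_size_cat ?size_iota // filter_cat.
rewrite (eq_in_filter (a2 := predT)) ?filter_predT; last first.
  by move=> i; rewrite mem_iota /=; lia.
rewrite (eq_in_filter (a2 := pred0)) ?filter_pred0 ?cats0 //.
by move=> i; rewrite mem_iota /=; lia.
Qed.

Lemma labels_enum s t1 t2 :
    sorted lto s -> (forall x, (x \in s) = (x \in t1) (+) (x \in t2)) ->
  labels (enum 'I_n) t1 t2 = [seq x \in t1 | x <- s].
Proof.
move=> s_sorted sP; rewrite /labels (filter_enum_ord s_sorted) // => x.
by rewrite sP !inE; case: (x \in t1); case: (x \in t2).
Qed.

Lemma labels_after v s1 s2 t1 t2 :
    sorted lto s1 -> sorted lto s2 ->
    all (fun x => v < x) s1 -> all (fun x => x <= v) s2 ->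
    (forall x, (x \in s1 ++ s2) = (x \in t1) (+) (x \in t2)) ->
  labels (vertices_after v) t1 t2 = [seq x \in t1 | x <- s1 ++ s2].
Proof.
move=> s1_sorted s2_sorted /allP s1v /allP s2v sP.
rewrite /labels vertices_afterE filter_cat.
congr (map _ (_ ++ _)); rewrite -filter_predI;
  apply: filter_enum_ord => // x;
  move/implyP: (s1v x) (s2v x) (sP x) => + /implyP +;
  rewrite !inE mem_cat ltnNge;
  by case: (x \in t1); case: (x \in t2); case: (x \in s1); case: (x \in s2);
     case: (x <= v).
Qed.

(** An empty label list matches no pattern. This lets the avoidance facts for [F] be applied without
    first checking that the two triangles differ. *)
Lemma labels_id s t : labels s t t = [::].
Proof.
rewrite /labels setUid setIid setDv (eq_filter (a2 := pred0)) ?filter_pred0 //.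
by move=> x; rewrite inE.
Qed.

Lemma crossing_after v s1 s2 t1 t2 :
    sorted lto s1 -> sorted lto s2 ->
    all (fun x => v < x) s1 -> all (fun x => x <= v) s2 ->
    (forall x, (x \in t1) && (x \in t2) = (x == v)) ->
    (forall x, (x \in s1 ++ s2) = (x \in t1) (+) (x \in t2)) ->
    [seq x \in t1 | x <- s1 ++ s2] = [:: true; false; true; false] \/
    [seq x \in t1 | x <- s1 ++ s2] = [:: false; true; false; true] ->
  forms Crossing t1 t2.
Proof.
move=> s1_sorted s2_sorted s1v s2v tv sP p; apply/existsP; exists v.
rewrite (labels_after s1_sorted s2_sorted s1v s2v sP).
apply/andP; split; last by case: p => ->.
by apply/eqP/setP=> x; rewrite !inE tv.
Qed.

Lemma swords_enum s t1 t2 :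
    sorted lto s ->
    (forall x, (x \in t1) && (x \in t2) = false) ->
    (forall x, (x \in s) = (x \in t1) (+) (x \in t2)) ->
    [seq x \in t1 | x <- s]
      \in variants [:: true; true; false; true; false; false] ->
  forms Swords t1 t2.
Proof.
move=> s_sorted t0 sP p; rewrite /= /share0 (labels_enum s_sorted sP) p andbT.
by apply/eqP/setP=> x; rewrite !inE t0.
Qed.

End Labels.

(** * Forbidden configurations as explicit vertex lists *)

Section Family.
Variables (n : nat) (F : {set {set 'I_n}}).
Hypothesis F_avoids : avoids [set Crossing; Swords] F.
Implicit Types a b c : 'I_n.

Lemma avoids_crossing t1 t2 : t1 \in F -> t2 \in F -> ~~ forms Crossing t1 t2.
Proof.
move=> Ft1 Ft2; have [<-|t12] := eqVneq t1 t2.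
  by apply/existsP=> -[v /andP[_]]; rewrite labels_id.
have /forall_inP/(_ _ Ft1)/forall_inP/(_ _ Ft2) := F_avoids.
by rewrite t12 => /forall_inP; apply; rewrite !inE eqxx.
Qed.

Lemma avoids_swords t1 t2 : t1 \in F -> t2 \in F -> ~~ forms Swords t1 t2.
Proof.
move=> Ft1 Ft2; have [<-|t12] := eqVneq t1 t2.
  by rewrite /= /share0 labels_id andbF.
have /forall_inP/(_ _ Ft1)/forall_inP/(_ _ Ft2) := F_avoids.
by rewrite t12 => /forall_inP; apply; rewrite !inE eqxx orbT.
Qed.

(** Bottom vertices carry larger numbers than top ones, so these inequalities place all vertices of
    two triples in linear order up to a few comparisons. *)
Definition triple_in (p : 'I_n * 'I_n * 'I_n) : bool :=
  [&& p.1.1 < p.1.2, p.1.2 < uphalf n, uphalf n <= p.2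
    & [set p.1.1; p.1.2; p.2] \in F].

Lemma swords_false s p a b c a' b' c' :
    triple_in (a, b, c) -> triple_in (a', b', c') ->
    sorted (fun x y : 'I_n => x < y) s ->
    s =i [:: a; b; c] ++ [:: a'; b'; c'] ->
    uniq ([:: a; b; c] ++ [:: a'; b'; c']) ->
    [seq x \in [:: a; b; c] | x <- s] = p ->
    p \in variants [:: true; true; false; true; false; false] -> False.
Proof.
case/and4P=> _ _ _ Ft /and4P[_ _ _ Ft'] s_sorted sE t_uniq sp p_sw.
have tE (x y z : 'I_n) : [set x; y; z] =i [:: x; y; z] by move=> u; rewrite !inE orbA.
have tI x := disjoint_uniq_cat x t_uniq.
apply: (negP (avoids_swords Ft Ft')); apply: (swords_enum s_sorted).
- by move=> x; rewrite !tE tI.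
- by move=> x; rewrite sE mem_cat !tE; have := tI x; do 2!case: (x \in _).
- by rewrite (eq_map (tE a b c)) sp.
Qed.

(** Here [v] is the shared vertex, [r] and [r'] are the remaining pairs, and [s1 ++ s2] lists these
    four vertices in cyclic order from [v], with [s2] the part that wraps past the end of the
    numbering. *)
Lemma crossing_false (v : 'I_n) (r r' s1 s2 : seq 'I_n) p a b c a' b' c' :
    triple_in (a, b, c) -> triple_in (a', b', c') ->
    [:: a; b; c] =i v :: r -> [:: a'; b'; c'] =i v :: r' ->
    uniq (v :: r ++ r') -> s1 ++ s2 =i r ++ r' ->
    sorted (fun x y : 'I_n => x < y) s1 ->
    sorted (fun x y : 'I_n => x < y) s2 ->
    all (fun x : 'I_n => v < x) s1 -> all (fun x : 'I_n => x <= v) s2 ->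
    [seq x \in [:: a; b; c] | x <- s1 ++ s2] = p ->
    p \in [:: [:: true; false; true; false]; [:: false; true; false; true]] ->
  False.
Proof.
case/and4P=> _ _ _ Ft /and4P[_ _ _ Ft'] rE r'E.
case/andP=> v_notin r_uniq sE s1_sorted s2_sorted s1v s2v sp p_cr.
have tE (x y z : 'I_n) : [set x; y; z] =i [:: x; y; z] by move=> u; rewrite !inE orbA.
have rI x := disjoint_uniq_cat x r_uniq.
apply: (negP (avoids_crossing Ft Ft')).
apply: (crossing_after s1_sorted s2_sorted s1v s2v) => [x|x|].
- by rewrite !tE rE r'E !inE; have := rI x; case: eqP => //= _.
- rewrite sE mem_cat !tE rE r'E !inE; have := rI x.
  have [->|_] := eqVneq x v; last by do 2!case: (x \in _).
  by rewrite -mem_cat (negPf v_notin).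
- rewrite (eq_map (tE a b c)) sp; move: p_cr; rewrite !inE.
  by case/orP=> /eqP->; [left | right].
Qed.

(** For concrete lists, equality of contents is a boolean case analysis, while sortedness,
    distinctness and each single label are arithmetic on vertex numbers. *)
Ltac solve_mem := move=> ?; rewrite ?(inE, mem_cat); repeat case: (_ == _).
Ltac solve_ord := rewrite /= ?inE -?val_eqE /=; lia.
Ltac solve_labels := rewrite /= ?inE -?val_eqE /=;
  repeat (apply: congr2; first by lia); reflexivity.
Ltac solve_swords :=
  by [| | solve_ord | solve_mem | solve_ord | solve_labels |].
Ltac solve_crossing :=
  by [| | solve_mem | solve_mem | solve_ord | solve_mem | solve_ord | solve_ord
      | solve_ord | solve_ord | solve_labels |].

(** * Order of the bottoms forced by the top intervals *)

(** If [c < c'], then [b = a'] gives a crossing at [b], read as [b', c, c'] and then [a] after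
    wrapping; [b < a'] gives swords. *)
Lemma separated_bottom a b c a' b' c' :
    triple_in (a, b, c) -> triple_in (a', b', c') ->
  b <= a' -> c' <= c.
Proof.
move=> t t'; have /and4P[/= ab bh hc _] := t.
have /and4P[/= ab' bh' hc' _] := t'.
move=> ba'; rewrite leqNgt; apply/negP=> cc'.
move: ba'; rewrite leq_eqVlt => /orP[/eqP/val_inj ba'|ba'].
  subst a'; apply: (@crossing_false b [:: a; c] [:: b'; c'] [:: b'; c; c']
    [:: a] [:: false; true; false; true] _ _ _ _ _ _ t t'); solve_crossing.
by apply: (@swords_false [:: a; b; a'; b'; c; c']
  [:: true; true; false; false; true; false] _ _ _ _ _ _ t t'); solve_swords.
Qed.

(** The inequality is strict because a common bottom vertex sees [a, a', b, b'] alternate, which is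
    a crossing. *)
Lemma interleaved_bottom a b c a' b' c' :
    triple_in (a, b, c) -> triple_in (a', b', c') ->
  a < a' -> a' < b -> b < b' -> c < c'.
Proof.
move=> t t'; have /and4P[/= ab bh hc _] := t.
have /and4P[/= ab' bh' hc' _] := t'.
move=> aa' a'b bb'; rewrite ltnNge; apply/negP.
rewrite leq_eqVlt => /orP[/eqP/val_inj cc'|c'c].
  subst c'; apply: (@crossing_false c [:: a; b] [:: a'; b'] [::]
    [:: a; a'; b; b'] [:: true; false; true; false] _ _ _ _ _ _ t t'); solve_crossing.
by apply: (@swords_false [:: a; a'; b; b'; c'; c]
  [:: true; false; true; false; false; true] _ _ _ _ _ _ t t'); solve_swords.
Qed.

(** Both strict orders of the bottoms give swords; a common bottom gives the permitted nested
    pair. *)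
Lemma nested_bottom a b c a' b' c' :
    triple_in (a, b, c) -> triple_in (a', b', c') ->
  a < a' -> b' < b -> c = c'.
Proof.
move=> t t'; have /and4P[/= ab bh hc _] := t.
have /and4P[/= ab' bh' hc' _] := t'.
move=> aa' b'b; apply: val_inj; case: (ltngtP c c') => // cc'; exfalso.
  by apply: (@swords_false [:: a; a'; b'; b; c; c']
    [:: true; false; false; true; true; false] _ _ _ _ _ _ t t'); solve_swords.
by apply: (@swords_false [:: a; a'; b'; b; c'; c]
  [:: true; false; false; true; false; true] _ _ _ _ _ _ t t'); solve_swords.
Qed.

Lemma same_left_bottom a b c b' c' :
  triple_in (a, b, c) -> triple_in (a, b', c') -> b < b' -> c' <= c.
Proof.
move=> t t'; have /and4P[/= ab bh hc _] := t.
have /and4P[/= ab' bh' hc' _] := t'.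
move=> bb'; rewrite leqNgt; apply/negP=> cc'.
by apply: (@crossing_false a [:: b; c] [:: b'; c'] [:: b; b'; c; c'] [::]
  [:: true; false; true; false] _ _ _ _ _ _ t t'); solve_crossing.
Qed.

Lemma same_right_bottom a b c a' c' :
  triple_in (a, b, c) -> triple_in (a', b, c') -> a < a' -> c' <= c.
Proof.
move=> t t'; have /and4P[/= ab bh hc _] := t.
have /and4P[/= ab' bh' hc' _] := t'.
move=> aa'; rewrite leqNgt; apply/negP=> cc'.
by apply: (@crossing_false b [:: a; c] [:: a'; c'] [:: c; c'] [:: a; a']
  [:: true; false; true; false] _ _ _ _ _ _ t t'); solve_crossing.
Qed.

(** Each relative position of two distinct intervals rules out at least one strict order of their
    bottoms, so both orders cannot occur. When both endpoints move the same way, the intervals are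
    either separated or interleaved, and the two cases contradict opposite hypotheses. *)
Lemma bottoms_ordered a b a' b' c1 c1' c2 c2' :
    triple_in (a, b, c1) -> triple_in (a', b', c1') -> c1 < c1' ->
    triple_in (a, b, c2) -> triple_in (a', b', c2') -> c2' < c2 ->
  (a, b) = (a', b').
Proof.
move=> t1 t1' c11 t2 t2' c22.
have /and4P[/= ab _ _ _] := t1; have /and4P[/= ab' _ _ _] := t1'.
case: (ltngtP a a') => [aa'|aa'|/val_inj aa'].
- have := @separated_bottom _ _ _ _ _ _ t1 t1'.
  have := @interleaved_bottom _ _ _ _ _ _ t2 t2' aa'.
  case: (ltngtP b b') => [bb'|bb'|/val_inj bb']; first by lia.
    by rewrite (nested_bottom t1 t1' aa' bb') ltnn in c11.
  by subst b'; have := same_right_bottom t1 t1' aa'; lia.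
- have := @separated_bottom _ _ _ _ _ _ t2' t2.
  have := @interleaved_bottom _ _ _ _ _ _ t1' t1 aa'.
  case: (ltngtP b' b) => [bb'|bb'|/val_inj bb']; first by lia.
    by rewrite (nested_bottom t1' t1 aa' bb') ltnn in c11.
  by subst b'; have := same_right_bottom t2' t2 aa'; lia.
- subst a'; case: (ltngtP b b') => [bb'|bb'|/val_inj ->] //.
    by have := same_left_bottom t1 t1' bb'; lia.
  by have := same_left_bottom t2' t2 bb'; lia.
Qed.

(** * Counting triples *)

Let least (p : 'I_n * 'I_n * 'I_n) : bool :=
  [forall c, triple_in (p.1, c) ==> (p.2 <= c)].
Let longest_right (p : 'I_n * 'I_n * 'I_n) : bool :=
  [forall b, forall c, triple_in (p.1.1, b, c) ==> (b <= p.1.2)].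
Let longest_left (p : 'I_n * 'I_n * 'I_n) : bool :=
  [forall a, forall c, triple_in (a, p.1.2, c) ==> (p.1.1 <= a)].

Lemma leastP p c : least p -> triple_in (p.1, c) -> p.2 <= c.
Proof. by move/forallP/(_ c)/implyP. Qed.

Lemma longest_right_or_left p :
  triple_in p -> longest_right p || longest_left p.
Proof.
case: p => -[a b] c t; apply/norP=> -[].
case/forallPn=> b1 /forallPn[c1]; rewrite negb_imply -ltnNge => /andP[/= t1 bb1].
case/forallPn=> a2 /forallPn[c2]; rewrite negb_imply -ltnNge => /andP[/= t2 a2a].
have /and4P[/= ab _ _ _] := t.
have := same_left_bottom t t1 bb1; have := same_right_bottom t2 t a2a.
(* The shared endpoints gave [c1 <= c <= c2], while [a2 < a < b < b1] yields [c2 < c1]. *)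
by have := interleaved_bottom t2 t1 a2a ab bb1; lia.
Qed.

Lemma card_triples : #|[set p | triple_in p]| <= 3 * n.
Proof.
pose Tc := [set p | triple_in p && ~~ least p].
pose Ta := [set p | [&& triple_in p, least p & longest_right p]].
pose Tb := [set p | [&& triple_in p, least p & longest_left p]].
have sub : [set p | triple_in p] \subset Tc :|: Ta :|: Tb.
  apply/subsetP=> p; rewrite !inE => t; rewrite t /=.
  by have := longest_right_or_left t; case: (least p).
have card_inj (A : {set 'I_n * 'I_n * 'I_n}) (f : 'I_n * 'I_n * 'I_n -> 'I_n) :
    {in A &, injective f} -> #|A| <= n.
  by move/card_in_imset=> <-; rewrite -[X in _ <= X]card_ord max_card.
have leTc : #|Tc| <= n.
  apply: (card_inj _ snd) => -[[a b] c] [[a' b'] c'].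
  rewrite !inE => /andP[t /forallPn[x]]; rewrite negb_imply -ltnNge.
  case/andP=> /= tx xc /andP[t' /forallPn[y]]; rewrite negb_imply -ltnNge.
  case/andP=> /= ty yc' cc'; subst c'.
  (* Both intervals carry the bottom [c], and [x], [y] are smaller bottoms over the first and the
     second. Pairing [x] with [c] and then [c] with [y] yields the two opposite orders. *)
  by rewrite (bottoms_ordered tx t' xc t ty yc').
have leTa : #|Ta| <= n.
  apply: (card_inj _ (fun p => p.1.1)) => -[[a b] c] [[a' b'] c'].
  rewrite !inE => /and3P[t m /forallP l] /and3P[t' m' /forallP l'] /= aa'.
  (* Maximality on both sides identifies the right endpoints; minimality of both bottoms then
     identifies [c] and [c']. *)
  subst a'; have /val_inj bb' : val b = val b'.
    have /forallP/(_ c')/implyP/(_ t') := l b'.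
    by have /forallP/(_ c)/implyP/(_ t) := l' b; rewrite /=; lia.
  subst b'; have /val_inj-> // : val c = val c'.
  by have := leastP m t'; have := leastP m' t; rewrite /=; lia.
have leTb : #|Tb| <= n.
  apply: (card_inj _ (fun p => p.1.2)) => -[[a b] c] [[a' b'] c'].
  rewrite !inE => /and3P[t m /forallP l] /and3P[t' m' /forallP l'] /= bb'.
  subst b'; have /val_inj aa' : val a = val a'.
    have /forallP/(_ c')/implyP/(_ t') := l a'.
    by have /forallP/(_ c)/implyP/(_ t) := l' a; rewrite /=; lia.
  subst a'; have /val_inj-> // : val c = val c'.
  by have := leastP m t'; have := leastP m' t; rewrite /=; lia.
apply: leq_trans (subset_leq_card sub) _.
have := leq_card_setU (Tc :|: Ta) Tb; have := leq_card_setU Tc Ta.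
by case=> + _ [+ _]; lia.
Qed.

(** * From triples back to triangles *)

Lemma top_top_bottomP t :
    top_top_bottom t ->
  exists a b c : 'I_n, [/\ a < b, b < uphalf n, uphalf n <= c
                         & t = [set a; b; c]].
Proof.
case/and3P=> _ /cards2P[a [b [ab tE]]] /cards1P[c cE].
have /setIP[_] : a \in t :&: top_half n by rewrite tE !inE eqxx.
have /setIP[_] : b \in t :&: top_half n by rewrite tE !inE eqxx orbT.
have /setIP[_] : c \in t :&: bottom_half n by rewrite cE !inE.
rewrite !inE -leqNgt => hc bh ah.
have {}tE : t = [set a; b; c] by rewrite -tE -cE -setIUr setUCr setIT.
case: (ltngtP a b) => [lt_ab|lt_ba|/val_inj ab_eq].
- by exists a, b, c.
- by exists b, a, c; split=> //; rewrite [[set b; a]]setUC.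
- by rewrite ab_eq eqxx in ab.
Qed.

Lemma card_avoiding_family :
  {in F, forall t, top_top_bottom t} -> #|F| <= 3 * n.
Proof.
move=> Ftop; apply: leq_trans card_triples.
(* The family lies in the image of the triples under [tri], and an image is no larger than its
   source. *)
pose tri (p : 'I_n * 'I_n * 'I_n) := [set p.1.1; p.1.2; p.2].
apply: leq_trans (leq_imset_card tri _); apply: subset_leq_card.
apply/subsetP=> t Ft.
have [a [b [c [ab bh hc tE]]]] := top_top_bottomP (Ftop t Ft).
by apply/imsetP; exists (a, b, c) => //; rewrite inE /triple_in /= ab bh hc -tE.
Qed.

End Family.

Theorem theorem9 :
  exists C N : nat, forall n : nat, N <= n ->
    ex' n [set Crossing; Swords] <= C * n.
Proof.
(* The factor 3 counts the classes [Tc], [Ta] and [Tb], each injecting into the vertices; the bound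
   holds from [n = 0] on. *)
exists 3, 0 => n _; apply/bigmax_leqP=> F /andP[/forall_inP Ftop F_avoids].
exact: card_avoiding_family.
Qed.
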